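(* There exist $2$-connected graphs with diameter three whose $MD$-numbers are arbitrarily large; that is, for every positive integer $N$ there is a $2$-connected graph $G$ with $diam(G)=3$ and $md(G)\geq N$.
   Context: Graphs are finite and simple. $diam(G)$ is the diameter of $G$. An edge-coloring of $G$ assigns a color (positive integer) to each edge; adjacent edges may have the same color. An edge-cut is monochromatic if all of its edges have the same color. An edge-coloring of $G$ is a monochromatic disconnection coloring ($MD$-coloring) if every two distinct vertices of $G$ are separated by a monochromatic edge-cut (i.e. there is a set of edges of a single color whose deletion puts the two vertices in different components). For a connected graph $G$, the $MD$-number $md(G)$ is the maximum number of colors used in an $MD$-coloring of $G$. *)

(* Defs.v *)
From mathcomp Require Import all_boot.
From mathcomp Require Import boolp.

Set Implicit Arguments.
Unset Strict Implicit.
Unset Printing Implicit Defensive.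

Record sgraph := SGraph {
  vertex :> finType;
  adj : rel vertex;
  adj_sym : symmetric adj;
  adj_irr : irreflexive adj
}.

Section Graphs.
Variable G : sgraph.

Definition edges : {set {set G}} :=
  [set f | [exists x, exists y, adj x y && (f == [set x; y])]].

(* Adjacency in the subgraph induced by A, on the vertex type of G. *)
Definition induced_adj (A : {set G}) : rel G :=
  [rel x y | [&& x \in A, y \in A & adj x y]].

Definition induced_connected (A : {set G}) : bool :=
  (A != set0) &&
  [forall x in A, forall y in A, connect (induced_adj A) x y].

Definition k_connected (k : nat) : bool :=
  (k < #|G|) &&
  [forall X : {set G}, (#|X| < k) ==> induced_connected (~: X)].

Definition walk_of_length (x y : G) (n : nat) : bool :=
  [exists p : n.-tuple G, path (@adj G) x p && (last x p == y)].

(* The least length of a walk from x to y. A shortest walk has length less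
   than #|G|, so only those lengths are searched; the junk value #|G| is
   returned when y is not reachable from x. *)
Definition dist (x y : G) : nat := find (walk_of_length x y) (iota 0 #|G|).

Definition diam : nat := \max_(x : G) \max_(y : G) dist x y.

(* A coloring is a function on all vertex sets, of which only the values on
   [edges] matter. *)
Definition edge_coloring (c : {set G} -> nat) : Prop :=
  forall f, f \in edges -> 0 < c f.

Definition num_colors (c : {set G} -> nat) : nat :=
  size (undup [seq c f | f in edges]).

Definition delete_edges (F : {set {set G}}) : rel G :=
  [rel x y | adj x y && ([set x; y] \notin F)].

Definition separates (F : {set {set G}}) (x y : G) : Prop :=
  ~~ connect (delete_edges F) x y.

Definition monochromatic (c : {set G} -> nat) (F : {set {set G}}) : Prop :=
  {in F &, forall f g, c f = c g}.

Definition MD_coloring (c : {set G} -> nat) : Prop :=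
  edge_coloring c /\
  forall x y : G, x != y ->
    exists F : {set {set G}},
      [/\ F \subset edges, monochromatic c F & separates F x y].

(* The bound on k loses nothing, a coloring having at most #|edges| colors;
   see [md_attained] and [md_max]. *)
Definition md : nat :=
  \max_(k < #|edges|.+1 | `[< exists c, MD_coloring c /\ num_colors c = k >]) k.

Lemma md_max c : MD_coloring c -> num_colors c <= md.
Proof.
move=> cMD.
have lec : num_colors c < #|edges|.+1.
  by rewrite ltnS /num_colors (leq_trans (size_undup _)) // size_map cardE.
rewrite /md; apply: (bigmax_sup (Ordinal lec)) => //.
by apply/asboolP; exists c.
Qed.

Lemma md_attained : exists c, MD_coloring c /\ num_colors c = md.
Proof.
pose P (k : 'I_#|edges|.+1) :=
  `[< exists c, MD_coloring c /\ num_colors c = k >].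
have MD1 : MD_coloring (fun=> 1).
  split=> // x y neq_xy; exists edges; split=> //.
  apply/negP=> /connectP[[|z p] /=].
    by move=> _ eq_yx; rewrite eq_yx eqxx in neq_xy.
  case/andP=> /andP[xz /negP xzNE] _ _; apply: xzNE; rewrite inE.
  by apply/existsP; exists x; apply/existsP; exists z; rewrite xz eqxx.
have le1 : num_colors (fun=> 1) < #|edges|.+1.
  by rewrite ltnS /num_colors (leq_trans (size_undup _)) // size_map cardE.
have P0 : P (Ordinal le1) by apply/asboolP; exists (fun=> 1).
rewrite /md (bigmax_eq_arg (Ordinal le1)) //.
by case: arg_maxnP => // k /asboolP.
Qed.

End Graphs.

(* Main.v *)
Require Import Defs.
From mathcomp Require Import all_boot.

(** Take a clique on the [2 * n] vertices [(i, s)] with [i < n] and [s] a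
    boolean, and attach to each clique edge [(i, false) (i, true)] an ear of
    three edges, that is, a quadrilateral on that edge. Each ear has two rungs,
    joining the clique to its two outer vertices, and a top edge. Clique edges
    and tops get color 1, and both rungs of ear [i] get color [i + 2].

    - Removing color 1 leaves only the rungs, so it separates any two vertices
      lying on different rungs; the two ends of a rung of ear [i] are separated
      by removing the color [i + 2], which cuts the top of ear [i] off the rest
      ([ear_coloring_MD]). At least [n] colors are used ([num_ear_colors]).
    - Outer vertices of distinct ears are at distance 3, through one edge of the
      clique, and no two vertices are further apart ([diam_ear_graph]).
    - Whatever vertex is removed, every other one still reaches the clique
      through one of the two rungs of its ear ([ear_graph_2connected]). *)

Set Implicit Arguments.
Unset Strict Implicit.
Unset Printing Implicit Defensive.

(** * Distances and cuts in an arbitrary graph *)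

Section Graphs.
Variable G : sgraph.
Implicit Types (x y : G) (c : {set G} -> nat).

Lemma dist_le x y (p : seq G) m :
  path (@adj G) x p -> last x p = y -> size p <= m -> dist x y <= m.
Proof.
move=> xp lastp; apply: leq_trans; rewrite /dist leqNgt; apply/negP => lt_p.
have lt_pG : size p < #|G|.
  by rewrite (leq_trans lt_p) // -[X in _ <= X](size_iota 0) find_size.
have /negP[] := negbT (before_find 0 lt_p); rewrite nth_iota // add0n.
by apply/existsP; exists (in_tuple p); rewrite /= xp lastp eqxx.
Qed.

Lemma dist_ge x y m : m <= #|G| ->
    (forall p : seq G, size p < m -> path (@adj G) x p -> last x p != y) ->
  m <= dist x y.
Proof.
move=> le_mG nop; rewrite leqNgt; apply/negP => lt_m.
have walk_xy : has (walk_of_length x y) (iota 0 #|G|).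
  by rewrite has_find size_iota (leq_trans lt_m).
have := nth_find 0 walk_xy; rewrite nth_iota; last exact: leq_trans lt_m _.
rewrite add0n => /existsP[p /andP[xp]]; apply/negP/nop => //.
by rewrite size_tuple.
Qed.

(** A map [h] that is constant along every edge not colored [k] is constant on
    the components left by deleting color [k]. *)
Lemma separated_by_color c k (T : eqType) (h : G -> T) x y :
    (forall u v, adj u v -> h u != h v -> c [set u; v] = k) -> h x != h y ->
  exists F : {set {set G}},
    [/\ F \subset edges G, monochromatic c F & separates F x y].
Proof.
move=> hk hxy; exists [set f in edges G | c f == k]; split.
- by apply/subsetP => f; rewrite inE => /andP[].
- by move=> f g; rewrite !inE => /andP[_ /eqP->] /andP[_ /eqP->].
apply/negP => /connectP[p xp def_y]; case/eqP: hxy; rewrite {y}def_y.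
elim: p x xp => //= y p IHp x /andP[/andP[xy xyF] /IHp <-].
apply/eqP; apply: contraNT xyF => hxy; rewrite !inE (hk _ _ xy hxy) eqxx andbT.
by apply/existsP; exists x; apply/existsP; exists y; rewrite xy eqxx.
Qed.

End Graphs.

(** * A clique with ears *)

Section EarGraph.
Variable n : nat.

(** The first component names a rung, [(i, s)] being the rung of ear [i] at its
    end [s]; the last one is true at the outer end of that rung. *)
Definition ear_vertex : finType := (('I_n * bool) * bool)%type.

Definition ear_adj : rel ear_vertex := fun x y =>
  (x != y) &&
  (if x.2 == y.2 then ~~ x.2 || (x.1.1 == y.1.1) else x.1 == y.1).

Lemma ear_adj_sym : symmetric ear_adj.
Proof.
move=> x y; rewrite /ear_adj eq_sym (eq_sym x.1) (eq_sym x.1.1) (eq_sym x.2).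
by case: (y.2 =P x.2) => // ->.
Qed.

Lemma ear_adj_irr : irreflexive ear_adj.
Proof. by move=> x; rewrite /ear_adj eqxx. Qed.

Definition ear_graph : sgraph := SGraph ear_adj_sym ear_adj_irr.

Lemma card_ear_graph : #|ear_graph| = n * 4.
Proof. by rewrite !card_prod card_ord card_bool -mulnA. Qed.

Lemma adj_clique (p q : 'I_n * bool) :
  p != q -> ear_adj (p, false) (q, false).
Proof. by move=> neq_pq; rewrite /ear_adj xpair_eqE negb_and neq_pq. Qed.

Lemma adj_top (i : 'I_n) (s : bool) :
  ear_adj (i, s, true) (i, ~~ s, true).
Proof. by rewrite /ear_adj !xpair_eqE !eqxx /=; case: s. Qed.

Lemma adj_rung (p : 'I_n * bool) (t : bool) :
  ear_adj (p, t) (p, ~~ t).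
Proof. by rewrite /ear_adj !xpair_eqE !eqxx /=; case: t. Qed.

(** ** Connectivity and diameter *)

(** If the inner end of the rung of [x] is the removed vertex, then the other
    rung of the same ear is intact. *)
Lemma connect_to_clique (X : {set ear_graph}) (x : ear_graph) :
    #|X| <= 1 -> x \in ~: X ->
  exists2 p : 'I_n * bool, (p, false) \in ~: X
    & connect (induced_adj (~: X)) x (p, false).
Proof.
move=> /card_le1_eqP X1; case: x => [[i s] []] xA; last by exists (i, s).
have [zX|zA] := boolP (((i, s), false) \in X); last first.
  exists (i, s); rewrite ?inE //; apply: connect1.
  by rewrite /induced_adj /= xA inE zA (adj_rung (i, s) true).
have otherA t : (i, ~~ s, t) \in ~: X.
  rewrite inE; apply/negP => /(X1 _ _ zX) [] /eqP.
  by case: (s).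
exists (i, ~~ s) => //.
apply: (@connect_trans _ _ (i, ~~ s, true)); apply: connect1.
  by rewrite /induced_adj /= xA otherA adj_top.
by rewrite /induced_adj /= !otherA (adj_rung (i, ~~ s) true).
Qed.

Lemma ear_graph_2connected : 0 < n -> k_connected ear_graph 2.
Proof.
move=> n_gt0; have lt2G : 2 < #|ear_graph|.
  by rewrite card_ear_graph (leq_trans _ (leq_mul n_gt0 (leqnn 4))).
rewrite /k_connected lt2G; apply/forallP => X; apply/implyP; rewrite ltnS => X1.
apply/andP; split.
  rewrite -card_gt0 -(ltn_add2l #|X|) addn0 cardsC.
  exact: leq_ltn_trans X1 (ltnW lt2G).
have sym : connect_sym (induced_adj (~: X)).
  apply: sym_connect_sym => u v; rewrite /induced_adj /= ear_adj_sym.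
  by rewrite !andbA (andbC (u \in _)).
apply/forall_inP => x xA; apply/forall_inP => y yA.
have [p pA xp] := connect_to_clique X1 xA.
have [q qA yq] := connect_to_clique X1 yA.
apply: connect_trans xp _; rewrite sym; apply: connect_trans yq _.
have [->|neq_qp] := eqVneq q p; first exact: connect0.
by apply: connect1; rewrite /induced_adj /= pA qA adj_clique.
Qed.

Lemma dist_ear_graph_le (x y : ear_graph) : dist x y <= 3.
Proof.
case: x y => p t [q u].
have [<-|neq_pq] := eqVneq p q.
  have [<-|] := eqVneq t u; first exact: (@dist_le ear_graph _ _ [::]).
  move=> neq_tu; have -> : u = ~~ t by case: t u neq_tu => [] [].
  apply: (@dist_le ear_graph _ _ [:: (p, ~~ t)]) => //.
  by rewrite /= adj_rung.
have pq := adj_clique neq_pq.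
case: t u => [] [].
- apply: (@dist_le ear_graph _ _ [:: (p, false); (q, false); (q, true)]) => //.
  by rewrite /= (adj_rung p true) pq (adj_rung q false).
- apply: (@dist_le ear_graph _ _ [:: (p, false); (q, false)]) => //.
  by rewrite /= (adj_rung p true) pq.
- apply: (@dist_le ear_graph _ _ [:: (q, false); (q, true)]) => //.
  by rewrite /= pq (adj_rung q false).
- apply: (@dist_le ear_graph _ _ [:: (q, false)]) => //.
  by rewrite /= pq.
Qed.

Lemma dist_outer_ge (i j : 'I_n) : i != j ->
  3 <= @dist ear_graph (i, false, true) (j, false, true).
Proof.
move=> neq_ij; apply: dist_ge.
  by rewrite card_ear_graph; case: n i {j neq_ij} => [[]|m _] //; rewrite mulSn.
case=> [|y [|z [|//]]] _ /=.
- by move=> _; rewrite !xpair_eqE (negPf neq_ij).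
- rewrite andbT => xy; apply: contraTneq xy => ->.
  by rewrite /ear_adj /= (negPf neq_ij) andbF.
(* The middle vertex of a walk of length 2 would lie in both ears. *)
case/and3P=> xy yz _; apply: contraTneq yz => z_j; rewrite {}z_j in y xy *.
have y1 : y.1.1 = i.
  by case: y xy => [[k s] []] /andP[_] /=; [move/eqP | case/eqP].
rewrite /ear_adj -pair_eqE /= y1 (negPf neq_ij) /=.
by case: y y1 {xy} => [[k s] []] /= ->; rewrite ?xpair_eqE (negPf neq_ij) ?andbF.
Qed.

Lemma diam_ear_graph : 1 < n -> diam ear_graph = 3.
Proof.
move=> n_gt1; apply/eqP; rewrite eqn_leq; apply/andP; split.
  apply/bigmax_leqP => x _; apply/bigmax_leqP => y _.
  exact: dist_ear_graph_le.
pose i := Ordinal (ltnW n_gt1); pose j := Ordinal n_gt1.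
apply: (bigmax_sup (i, false, true)) => //.
apply: (bigmax_sup (j, false, true)) => //.
exact: dist_outer_ge.
Qed.

(** ** The coloring *)

Definition rung (p : 'I_n * bool) : {set ear_graph} :=
  [set (p, false); (p, true)].

Definition ear_coloring (f : {set ear_graph}) : nat :=
  if [pick p | f == rung p] is Some p then p.1.+2 else 1.

Lemma ear_coloring_rung p : ear_coloring (rung p) = p.1.+2.
Proof.
rewrite /ear_coloring; case: pickP => [q /eqP/setP/(_ (p, true))|].
  by rewrite !inE !xpair_eqE !eqxx orbT andbF andbT /= => /esym/eqP->.
by move/(_ p); rewrite eqxx.
Qed.

Lemma rung_pair p t : [set (p, t); (p, ~~ t)] = rung p.
Proof. by case: t; rewrite // setUC. Qed.

Lemma ear_coloring_not_rung (u v : ear_graph) :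
  u.1 != v.1 -> ear_coloring [set u; v] = 1.
Proof.
move=> neq_uv; rewrite /ear_coloring; case: pickP => // p /eqP uv_p.
have in_rung w : w \in rung p -> w.1 = p.
  by rewrite !inE => /orP[] /eqP->.
case/eqP: neq_uv.
by rewrite !in_rung // -uv_p !inE eqxx ?orbT.
Qed.

Lemma ear_coloring_MD : MD_coloring ear_coloring.
Proof.
split=> [f _|x y neq_xy]; first by rewrite /ear_coloring; case: pickP.
have [eq_xy|] := eqVneq x.1 y.1; last first.
  by apply: (separated_by_color (k := 1)) => u v _; apply: ear_coloring_not_rung.
(* The two sides of the cut are the top of the ear of [x] and the rest. *)
pose top (z : ear_graph) := z.2 && (z.1.1 == x.1.1).
apply: (separated_by_color (k := x.1.1.+2) (h := top)); last first.
  by move: neq_xy; rewrite -pair_eqE /pair_eq /top eq_xy !eqxx /= !andbT.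
move=> [p t] [q u] /andP[_] /=; rewrite /top /=.
have [<-|neq_tu] := eqVneq t u.
  by case: t => //= /eqP->; rewrite eqxx.
move=> /eqP<-; have -> : u = ~~ t by case: t u neq_tu => [] [].
rewrite rung_pair ear_coloring_rung.
by case: (p.1 =P x.1.1) => [->|] //; rewrite !andbF.
Qed.

Lemma num_ear_colors : n <= num_colors ear_coloring.
Proof.
rewrite -[X in X <= _](size_enum_ord n) -(size_map (fun i : 'I_n => i.+2)).
apply: uniq_leq_size.
  by rewrite map_inj_uniq ?enum_uniq // => i j [] /val_inj.
move=> k /mapP[i _ ->]; rewrite mem_undup; apply/mapP.
exists (rung (i, false)); last by rewrite ear_coloring_rung.
rewrite mem_enum inE; apply/existsP; exists (i, false, false).
apply/existsP; exists (i, false, true).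
by rewrite eqxx andbT; apply: (adj_rung (i, false) false).
Qed.

End EarGraph.

Theorem mainTheorem6 :
  forall N : nat, 0 < N ->
    exists G : sgraph, [/\ k_connected G 2, diam G = 3 & N <= md G].
Proof.
(* A second ear is needed for the diameter to reach 3. *)
move=> N N_gt0; exists (ear_graph N.+1); split.
- exact: ear_graph_2connected.
- exact: diam_ear_graph.
apply: leq_trans (leqnSn N) _.
exact: leq_trans (num_ear_colors _) (md_max (ear_coloring_MD _)).
Qed.
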